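(* Let $n$ and $k$ be integers with $3\le k\le n-1$, and let $G$ be any unicyclic graph with $n$ vertices whose unique cycle has length $k$. Then $F(G)\ge F(L_{n,k})$, with equality if and only if $G\cong L_{n,k}$.
   Context: All graphs are finite and simple. The F-index of a graph $G$ is $F(G)=\sum_{v\in V(G)} d_G(v)^3$, where $d_G(v)$ denotes the degree of $v$. A unicyclic graph is a connected graph containing exactly one cycle. For $3\le k\le n-1$, the lollipop $L_{n,k}$ is the unicyclic graph of order $n$ obtained from vertex-disjoint copies of the cycle $C_k$ and the path $P_{n-k}$ (on $n-k$ vertices) by adding an edge joining a vertex of $C_k$ to an end vertex of $P_{n-k}$. *)

(* Defs.v *)
From mathcomp Require Import all_boot.

Set Implicit Arguments.
Unset Strict Implicit.
Unset Printing Implicit Defensive.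

Record sgraph := SGraph {
  vertex :> finType;
  adj : rel vertex;
  adj_sym : symmetric adj;
  adj_irrefl : irreflexive adj
}.

Definition degree (G : sgraph) (v : G) : nat := #|[set w : G | adj v w]|.

Definition F_index (G : sgraph) : nat := \sum_(v : G) degree v ^ 3.

Definition connected_graph (G : sgraph) : Prop :=
  forall x y : G, connect (@adj G) x y.

Definition is_cycle (G : sgraph) (c : seq G) : bool :=
  (2 < size c) && ucycleb (@adj G) c.

(* A cycle is a subgraph, whereas the same cycle is listed by several          *)
(* sequences, differing by rotation and reversal; two sequences list the same  *)
(* cycle when their edge sets coincide.                                        *)
Definition cycle_edges (G : sgraph) (c : seq G) : {set {set G}} :=
  [set [set x; next c x] | x in c].

Definition unicyclic (G : sgraph) : Prop :=
  connected_graph G /\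
  exists2 c : seq G, is_cycle c &
    forall c' : seq G, is_cycle c' -> cycle_edges c' = cycle_edges c.

Definition graph_iso (G H : sgraph) : Prop :=
  exists2 f : G -> H, bijective f & forall x y : G, adj (f x) (f y) = adj x y.

(* The condition i != j only matters for k = 1, where it removes a loop.       *)
Definition cycle_adj (k : nat) : rel 'I_k :=
  fun i j => (i != j) && ((i.+1 %% k == j) || (j.+1 %% k == i)).

Definition path_adj (m : nat) : rel 'I_m :=
  fun i j => (i.+1 == j) || (j.+1 == i).

(* The joining edge is the one between vertex 0 of the cycle and the end       *)
(* vertex 0 of the path; other choices give isomorphic graphs.                 *)
Definition lollipop_adj (k m : nat) : rel ('I_k + 'I_m)%type :=
  fun u v =>
    match u, v with
    | inl i, inl j => cycle_adj i j
    | inr i, inr j => path_adj i j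
    | inl i, inr j => (val i == 0) && (val j == 0)
    | inr i, inl j => (val i == 0) && (val j == 0)
    end.

Lemma lollipop_adj_sym k m : symmetric (@lollipop_adj k m).
Proof.
move=> [i|i] [j|j] /=; rewrite /cycle_adj /path_adj.
- by rewrite eq_sym orbC.
- exact: andbC.
- exact: andbC.
- exact: orbC.
Qed.

Lemma lollipop_adj_irrefl k m : irreflexive (@lollipop_adj k m).
Proof.
move=> [i|i] /=; rewrite /cycle_adj /path_adj ?eqxx //.
by rewrite orbb gtn_eqF.
Qed.

Definition lollipop (n k : nat) : sgraph :=
  SGraph (@lollipop_adj_sym k (n - k)) (@lollipop_adj_irrefl k (n - k)).

(* Main.v *)
(* For a degree [d], [12 d <= d ^ 3 + 16], an equality only at [d = 2], with
   excess at least 7 for [d >= 3] and at least 5 for [d <= 1].  The degrees sum to at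
   least [2 n], some vertex of the cycle has degree at least 3, and a maximal
   path leaving the cycle ends in a vertex of degree 1, as any further neighbour
   of its end would close a second cycle; hence [F(G) >= 8 n + 12 = F(L)].
   In case of equality the cycle and the path form a lollipop none of whose
   vertices has a neighbour outside it, so by connectedness it is all of [G]. *)
Require Import Defs.
From mathcomp Require Import all_boot.
From mathcomp Require Import zify.

Set Implicit Arguments.
Unset Strict Implicit.
Unset Printing Implicit Defensive.

(** * Degree sum of a connected graph containing a cycle *)

Lemma connected_closed_mem (G : sgraph) (A : {pred G}) (x0 : G) :
  connected_graph G -> x0 \in A ->
  (forall x y : G, adj x y -> x \in A -> y \in A) -> forall y, y \in A.
Proof.
move=> conG Ax0 clA y.
have clos: closed (@adj G) A.
  by apply: intro_closed clA; apply/sym_connect_sym/(@adj_sym G).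
by rewrite -(closed_connect clos (conG x0 y)).
Qed.

Lemma degreeE (G : sgraph) (x : G) : degree x = \sum_(y : G) adj x y.
Proof.
by rewrite /degree -sum1dep_card big_mkcond; apply: eq_bigr => y _; case: adj.
Qed.

(** Edges are taken as ordered pairs, so that the count over all vertices is the degree sum
    itself. *)
Definition arcs (G : sgraph) (A : {set G}) : {set G * G} :=
  [set p | [&& p.1 \in A, p.2 \in A & adj p.1 p.2]].

Lemma card_arcsT (G : sgraph) : #|arcs [set: G]| = \sum_(x : G) degree x.
Proof.
under eq_bigr do rewrite degreeE.
rewrite pair_bigA /= -sum1dep_card big_mkcond.
by apply: eq_bigr => p _ /=; rewrite !inE /=; case: adj.
Qed.

(** Adding to [A] an outside neighbour adds one vertex and at least the two arcs of the joining
    edge, which preserves the bound. By connectedness this stops only at the whole vertex set. *)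
Lemma card_arcs_growth (G : sgraph) (A : {set G}) :
  connected_graph G -> A != set0 -> 2 * #|A| <= #|arcs A| ->
  2 * #|G| <= #|arcs [set: G]|.
Proof.
move=> conG; have [m] := ubnP #|~: A|.
elim: m A => // m IHm A ltAm Ann0 leA.
have [/existsP[x /existsP[y /and3P[Ax Ay xy]]]|] :=
    boolP [exists x, exists y, [&& x \in A, y \notin A & adj x y]].
  apply: (IHm (y |: A)).
  - have: #|~: (y |: A)| < #|~: A|; last by lia.
    apply: proper_card; apply/properP; split.
      by rewrite setCS subsetUr.
    by exists y; rewrite !inE ?eqxx.
  - by apply/set0Pn; exists y; rewrite setU11.
  - have nxy: x != y by apply: contraNneq Ay => <-.
    have sub: (x, y) |: ((y, x) |: arcs A) \subset arcs (y |: A).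
      apply/subsetP=> -[a b]; rewrite !inE /= !xpair_eqE.
      case/or3P=> [/andP[/eqP-> /eqP->]|/andP[/eqP-> /eqP->]|/and3P[-> -> ->]].
      + by rewrite Ax xy eqxx orbT.
      + by rewrite Ax adj_sym xy eqxx orbT.
      + by rewrite !orbT.
    move/subset_leq_card: sub; rewrite !cardsU1 !inE /= !xpair_eqE (negPf Ay).
    rewrite (negPf nxy) andbF /= addnA mulnDr => le2.
    by apply: leq_trans le2; apply: leq_add.
move=> nex; case/set0Pn: Ann0 => x0 Ax0.
have AT: A = setT.
  apply/setP=> y; rewrite inE; apply: (connected_closed_mem conG Ax0) => a b ab Aa.
  apply: contraNT nex => Ab; apply/existsP; exists a; apply/existsP; exists b.
  by rewrite Aa Ab.
by move: leA; rewrite AT cardsT.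
Qed.

(** This keeps the arcs of a cycle in one direction apart from those in the other. *)
Lemma next_next_neq (T : eqType) (c : seq T) (x : T) :
  uniq c -> 2 < size c -> x \in c -> next c (next c x) != x.
Proof.
move=> Uc sc xc; case/rot_to: (xc) => i [|y [|z s]] def_c.
- by have := size_rot i c; rewrite def_c /=; lia.
- by have := size_rot i c; rewrite def_c /=; lia.
have nE t : next c t = next [:: x, y, z & s] t by rewrite -def_c next_rot.
have: uniq (rot i c) by rewrite rot_uniq.
rewrite def_c !nE /= eqxx !inE !negb_or => /andP[/and3P[xy xz _] _].
by rewrite [y == x]eq_sym (negPf xy) eqxx eq_sym.
Qed.

(** The growth starts from the cycle, which has [size c] arcs in each direction. *)
Lemma sum_degree_ge (G : sgraph) (c : seq G) :
  connected_graph G -> is_cycle c -> 2 * #|G| <= \sum_(x : G) degree x.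
Proof.
move=> conG /andP[sc /andP[cc Uc]]; rewrite -card_arcsT.
apply: (@card_arcs_growth _ [set x in c]) => //.
  by apply/set0Pn; case: c sc {cc Uc} => // x s _; exists x; rewrite inE mem_head.
have cE : #|[set x in c]| = size c by rewrite cardsE; apply/card_uniqP.
pose B := [set (x, next c x) | x in [set x in c]].
pose B' := [set (next c x, x) | x in [set x in c]].
have cB : #|B| = size c by rewrite card_imset // => x y [].
have cB' : #|B'| = size c by rewrite card_imset // => x y [].
have dis: [disjoint B & B'].
  apply/pred0P=> -[a b] /=; apply/negP=> /andP[/imsetP[x]].
  rewrite inE => xc [-> ->] /imsetP[y]; rewrite inE => yc [exy eyx].
  by have := next_next_neq Uc sc yc; rewrite -exy eyx eqxx.
have: B :|: B' \subset arcs [set x in c].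
  apply/subsetP=> p; rewrite inE => /orP[] /imsetP[x]; rewrite inE => xc -> /=.
    by rewrite !inE /= mem_next xc next_cycle.
  by rewrite !inE /= mem_next xc adj_sym next_cycle.
move/subset_leq_card; rewrite cE cardsU.
by move: dis; rewrite -setI_eq0 => /eqP->; rewrite cards0 subn0 cB cB' mul2n -addnn.
Qed.

(** * From the cycle along a path to a vertex of degree at most 1 *)

Lemma unicyclic_mem_cycle (G : sgraph) (c c' : seq G) :
  unicyclic G -> is_cycle c -> is_cycle c' -> {subset c' <= c}.
Proof.
move=> [_ [c0 _ U0]] cc cc' x xc'.
have: [set x; next c' x] \in cycle_edges c.
  by rewrite (U0 c cc) -(U0 c' cc'); apply/imsetP; exists x.
case/imsetP=> y yc /setP/(_ x); rewrite !inE eqxx /=.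
by case/esym/orP=> /eqP->; rewrite ?mem_next.
Qed.

Lemma is_cycle_rot (G : sgraph) (c : seq G) i : is_cycle (rot i c) = is_cycle c.
Proof. by rewrite /is_cycle /ucycleb size_rot rot_cycle rot_uniq. Qed.

Lemma degree_gt1_other (G : sgraph) (x z : G) :
  1 < degree x -> exists2 y, adj x y & y != z.
Proof.
move=> d1; have [/existsP[y /andP[]]|] := boolP [exists y, adj x y && (y != z)].
  by exists y.
move=> nex; have: [set y | adj x y] \subset [set z].
  apply/subsetP=> y; rewrite !inE => xy; apply: contraNT nex => yz.
  by apply/existsP; exists y; rewrite xy.
by move/subset_leq_card; rewrite cards1 leqNgt -/(degree x) d1.
Qed.

(** The path is extended while its end [x] has a neighbour other than its predecessor. That
    neighbour is always new: otherwise it would close a cycle through [x], a vertex off the given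
    cycle. *)
Lemma path_to_leaf (G : sgraph) (v x : G) (c q : seq G) :
  is_cycle (v :: c) ->
  (forall c' : seq G, is_cycle c' -> {subset c' <= v :: c}) ->
  path (@adj G) v (rcons q x) -> uniq ((v :: c) ++ rcons q x) ->
  exists r y, [/\ path (@adj G) v (rcons r y), uniq ((v :: c) ++ rcons r y)
                & degree y <= 1].
Proof.
move=> cyc sub; have [m] := ubnP (#|G| - size q).
elim: m q x => // m IHm q x ltqm pq Uq.
have [d1|] := leqP (degree x) 1; first by exists q, x.
case/(degree_gt1_other (last v q)) => y xy nyq.
have szq : size q < #|G|.
  have := uniq_leq_size Uq (fun y _ => mem_enum G y).
  by rewrite -cardE size_cat size_rcons /=; lia.
have [yin|ynin] := boolP (y \in (v :: c) ++ rcons q x); last first.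
  apply: (IHm (rcons q x) y).
  - by rewrite size_rcons; lia.
  - by rewrite rcons_path pq last_rcons.
  - by rewrite -rcons_cat rcons_uniq ynin.
have xnc : x \notin v :: c.
  move: Uq; rewrite cat_uniq => /and3P[_ /hasPn/(_ x) H _].
  by apply: H; rewrite mem_rcons mem_head.
have Uvq : uniq (rcons (v :: q) x).
  move: Uq; rewrite cat_uniq => /and3P[_ /hasPn H Uqx].
  rewrite rcons_cons /= Uqx andbT; apply/negP=> /H.
  by rewrite inE eqxx.
suff [c' cc' xc'] : exists2 c', is_cycle c' & x \in c'.
  by case/negP: xnc; apply: sub cc' _ xc'.
(* If [y] is on the path, the stretch from [y] to [x] closes up. It has at least three vertices
   because [y] is not the predecessor of [x]. *)
have [yvq|nyvq] := boolP (y \in v :: q).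
  have: sorted (@adj G) (rcons (v :: q) x) by [].
  have: last v (v :: q) != y by rewrite /= eq_sym.
  move: Uvq; case/splitPr: yvq => a b.
  rewrite last_cat rcons_cat cat_uniq => /and3P[_ _ Ub] /= nb.
  move/cat_sorted2=> [_ /= pb].
  exists (y :: rcons b x); last by rewrite inE mem_rcons mem_head orbT.
  rewrite /is_cycle /ucycleb /= rcons_path pb last_rcons xy.
  by case: b nb Ub {pb} => [|b0 b] /=; rewrite ?eqxx // size_rcons => _ ->.
(* Otherwise [y] is on the cycle and differs from [v]: go from [v] along the path to [x], cross to
   [y] and follow the cycle back to [v]. *)
have yc : y \in c.
  move: yin nyvq; rewrite mem_cat !inE mem_rcons inE.
  case: (eqVneq y x) => [eyx|_]; first by rewrite eyx adj_irrefl in xy.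
  by case: (y == v) => //=; case: (y \in q); rewrite ?orbT ?orbF.
move: cyc Uq => /andP[_ /andP[+ _]]; case/splitPr: yc => a b cyc Uq.
move: cyc; rewrite /= rcons_cat cat_path /= => /and3P[_ _ pb].
exists (v :: rcons q x ++ y :: b); last first.
  by rewrite inE mem_cat mem_rcons mem_head orbT.
have permE : perm_eq (v :: rcons q x ++ y :: b) (v :: (y :: b) ++ rcons q x).
  by rewrite perm_cons perm_catC.
have -> : is_cycle (v :: rcons q x ++ y :: b) =
          uniq (v :: rcons q x ++ y :: b).
  rewrite /is_cycle /ucycleb /cycle rcons_cat cat_path pq last_rcons /= xy pb.
  by rewrite size_cat size_rcons /= addnS.
rewrite (perm_uniq permE); apply: subseq_uniq Uq; rewrite /= eqxx -catA.
exact: suffix_subseq.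
Qed.

(** * Degrees and F-index of the lollipop *)

(* The shift of both lengths makes the end vertices definable as [ord0] and
   [ord_max]. *)
Definition pan (k m : nat) : sgraph :=
  SGraph (@lollipop_adj_sym k.+3 m.+1) (@lollipop_adj_irrefl k.+3 m.+1).

Definition joint (k m : nat) : pan k m := inl ord0.
Definition tip (k m : nat) : pan k m := inr ord_max.

Lemma cycle_adjE (k : nat) (i j : 'I_k.+3) :
  cycle_adj i j = (j \in pred2 (ordS i) (ord_pred i)).
Proof.
rewrite /cycle_adj !inE -(can2_eq (@ordSK _) (@ord_predK _)) -!val_eqE /=.
rewrite [X in _ && (X || _)]eq_sym.
case: (eqVneq (val i) j) => //= <-; apply/esym/norP.
have := ltn_ord i; rewrite leq_eqVlt => /orP[/eqP[->]|lt].
  by rewrite modnn.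
by rewrite modn_small //; split; lia.
Qed.

Lemma sum_ord_pred1 (m a : nat) : \sum_(j < m) (a == j) = (a < m).
Proof.
case: ltnP => [lt|ge].
  rewrite (bigD1 (Ordinal lt)) //= eqxx big1 // => j; rewrite -val_eqE /= eq_sym.
  by move/negPf->.
by rewrite big1 // => j _; rewrite gtn_eqF // (leq_trans _ ge).
Qed.

(** The indicators stand on opposite sides to avoid truncated subtraction; the equality case of the
    cubic bound on degrees has the same shape. *)
Lemma degree_pan (k m : nat) (u : pan k m) :
  degree u + (u == tip k m) = 2 + (u == joint k m).
Proof.
rewrite degreeE big_sumType /=; case: u => i /=.
  have -> : \sum_(j < k.+3) cycle_adj i j = 2.
    under eq_bigr do rewrite cycle_adjE.
    rewrite -big_mkcond sum1_card card2.
    suff -> : ordS i != ord_pred i by [].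
    rewrite -(can2_eq (@ordSK _) (@ord_predK _)) -val_eqE /=.
    (* The second successor of [i] differs from [i]: the cases are [i] last, [i] last but one, and
       no wrap-around. *)
    have := ltn_ord i; rewrite leq_eqVlt => /orP[/eqP[->]|].
      by rewrite modnn !modn_small.
    rewrite ltnS leq_eqVlt => /orP[/eqP[->]|lt].
      by rewrite (@modn_small k.+2) // modnn.
    by rewrite !modn_small //; lia.
  rewrite big_ord_recl big1 /= ?andbT => [|j _]; last by rewrite andbF.
  by rewrite !addn0.
rewrite big_ord_recl big1 /= ?andbT => [|j _]; last by rewrite andbF.
have -> : \sum_(j < m.+1) path_adj i j = (i < m) + (0 < i).
  (* The factor [0 < i] removes the spurious predecessor coming from [0.-1 = 0]. *)
  transitivity (\sum_(j < m.+1) ((i.+1 == j) + (0 < i) * (i.-1 == j))).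
    by apply: eq_bigr => j _; rewrite /path_adj; case: (val i) => [|a] /=; lia.
  rewrite big_split /= -big_distrr /= !sum_ord_pred1.
  by have := ltn_ord i; lia.
have -> : (inr i == tip k m) = (i == m :> nat) by [].
by have := ltn_ord i; case: (val i) => [|a]; lia.
Qed.

Lemma degree_joint (k m : nat) : degree (joint k m) = 3.
Proof. by have := degree_pan (joint k m); rewrite eqxx addn0. Qed.

Lemma F_index_pan (k m : nat) : F_index (pan k m) = 8 * (k.+3 + m.+1) + 12.
Proof.
have card_pan : \sum_(u : pan k m) 8 = 8 * (k.+3 + m.+1).
  by rewrite sum_nat_const cardE -cardT card_sum !card_ord mulnC.
have jointT : joint k m != tip k m by [].
rewrite /F_index (bigD1 (joint k m)) //= (bigD1 (tip k m)) //=.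
move: card_pan; rewrite (bigD1 (joint k m)) //= (bigD1 (tip k m)) //= => <-.
rewrite degree_joint; have -> : degree (tip k m) = 1.
  have := degree_pan (tip k m).
  by rewrite eqxx [_ == joint k m]eq_sym (negPf jointT) addn1 => -[].
rewrite (eq_bigr (fun=> 8)) => [|u /andP[uj ut]]; first by lia.
by have := degree_pan u; rewrite (negPf uj) (negPf ut) !addn0 => ->.
Qed.

(** * Injective homomorphisms and isomorphisms *)

Lemma degree_hom_le (H G : sgraph) (f : H -> G) (u : H) :
  injective f -> (forall x y : H, adj x y -> adj (f x) (f y)) ->
  degree u <= degree (f u).
Proof.
move=> fI fH; rewrite /degree -(card_imset _ fI); apply: subset_leq_card.
by apply/subsetP=> y /imsetP[x]; rewrite !inE => ux ->; apply: fH.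
Qed.

(** By the degree bound, [f] maps the neighbourhood of [u] onto that of [f u]. Hence [f] reflects
    adjacency and its image is closed under adjacency, so it is everything by connectedness; the
    isomorphism is the inverse of [f]. *)
Lemma hom_degree_iso (H G : sgraph) (f : H -> G) (u0 : H) :
  connected_graph G -> injective f ->
  (forall x y : H, adj x y -> adj (f x) (f y)) ->
  (forall u, degree (f u) <= degree u) -> graph_iso G H.
Proof.
move=> conG fI fH fd.
have nbhE u : [set y | adj (f u) y] = f @: [set x | adj u x].
  apply/esym/eqP; rewrite eqEcard (card_imset _ fI) [X in _ && X]fd andbT.
  by apply/subsetP=> y /imsetP[x]; rewrite !inE => ux ->; apply: fH.
have fE x y : adj (f x) (f y) = adj x y.
  by have /setP/(_ (f y)) := nbhE x; rewrite !inE (mem_imset _ _ fI) inE.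
have surj y : y \in codom f.
  apply: (connected_closed_mem (x0 := f u0) conG); first exact: codom_f.
  move=> a b ab /codomP[u eau]; move: ab; rewrite eau => ab.
  have : b \in [set y | adj (f u) y] by rewrite inE.
  by rewrite nbhE => /imsetP[x _ ->]; apply: codom_f.
have fK y : f (iinv (surj y)) = y by apply: f_iinv.
exists (fun y => iinv (surj y)); last by move=> x y; rewrite -fE !fK.
by exists f => // x; apply: fI; rewrite fK.
Qed.

Lemma graph_iso_F_index (G H : sgraph) : graph_iso G H -> F_index G = F_index H.
Proof.
case=> f fB fE; have fI := bij_inj fB.
have fdeg x : degree (f x) = degree x.
  rewrite !degreeE (reindex f) /=; last exact: onW_bij.
  by apply: eq_bigr => y _; rewrite fE.
rewrite /F_index [RHS](reindex f) /=; last exact: onW_bij.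
by apply: eq_bigr => x _; rewrite fdeg.
Qed.

(** * The cubic bound, a lollipop inside the graph, and the conclusion *)

(* [d ^ 3 + 16 - 12 * d = (d - 2) ^ 2 * (d + 4)] *)
Lemma cube_degree_leqif (d : nat) (j t : bool) :
  ~~ (j && t) -> (j -> 3 <= d) -> (t -> d <= 1) ->
  12 * d + (7 * j + 5 * t) <= d ^ 3 + 16 ?= iff (d + t == 2 + j).
Proof.
case: j t d => [] [] [|[|[|[|d]]]] //= jt jd td; rewrite ?(expnS, expn0).
all: try by have := jd isT.
all: try by have := td isT.
all: by split; nia.
Qed.

Lemma pan_hom (G : sgraph) (c : seq G) :
  connected_graph G -> is_cycle c ->
  (forall c' : seq G, is_cycle c' -> {subset c' <= c}) -> size c < #|G| ->
  exists k m (f : pan k m -> G),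
    [/\ size c = k.+3, injective f,
        forall x y : pan k m, adj x y -> adj (f x) (f y)
      & degree (f (tip k m)) <= 1].
Proof.
move=> conG cyc sub ltc.
(* The cycle misses some vertex, so by connectedness an edge leaves it. *)
have [v vc [w wnc vw]] : exists2 v, v \in c & exists2 w, w \notin c & adj v w.
  have [/existsP[v /existsP[w /and3P[]]]|] :=
      boolP [exists v, exists w, [&& v \in c, w \notin c & adj v w]].
    by exists v => //; exists w.
  move=> nex; move: ltc; rewrite ltnNge cardT; case/negP.
  apply: uniq_leq_size (enum_uniq _) _ => y _.
  have [x0 x0c] : exists x0, x0 \in c.
    by move: cyc => /andP[]; case: (c) => // x s _ _; exists x; apply: mem_head.
  apply: (connected_closed_mem conG x0c) => a b ab ac.
  apply: contraNT nex => bc; apply/existsP; exists a; apply/existsP; exists b.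
  by rewrite ac bc.
case/rot_to: vc => i c1 def_c.
have cycv : is_cycle (v :: c1) by rewrite -def_c is_cycle_rot.
have subv c' : is_cycle c' -> {subset c' <= v :: c1}.
  by move=> /sub c'c x /c'c; rewrite -def_c mem_rot.
have wnv : w \notin v :: c1 by rewrite -def_c mem_rot.
have [r [y [pr Ur dy]]] : exists r y,
    [/\ path (@adj G) v (rcons r y), uniq ((v :: c1) ++ rcons r y) & degree y <= 1].
  apply: (@path_to_leaf G v w c1 [::]) => //; first by rewrite /= vw.
  by rewrite cats1 rcons_uniq wnv; case/and3P: cycv.
have szc : size c = (size c1).+1 by rewrite -(size_rot i) def_c.
have szc1 : 1 < size c1 by case/andP: cycv.
have [k ks] : exists k, size c1 = k.+2.
  by case: (size c1) szc1 => [|[|k]] // _; exists k.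
pose f (u : pan k (size r)) : G :=
  match u with inl a => nth v (v :: c1) a | inr b => nth v (rcons r y) b end.
(* Cycle and path are read off one sequence without repetition, which reduces injectivity of [f] to
   that of the index. *)
have fnth u : f u = nth v ((v :: c1) ++ rcons r y)
    (match u with inl a => val a | inr b => k.+3 + val b end).
  case: u => a; rewrite nth_cat /=.
    by rewrite ks ltn_ord.
  by rewrite ks ltnNge leq_addr /= addKn.
exists k, (size r), f; split.
- by rewrite szc ks.
- move=> x x'; rewrite !fnth => /eqP; rewrite nth_uniq //.
  + case: x x' => a [] b /eqP /= e.
    * by congr inl; apply: val_inj.
    * by have := ltn_ord a; rewrite e ltnNge leq_addr.
    * by have := ltn_ord b; rewrite -e ltnNge leq_addr.
    * by congr inr; apply: val_inj; move: e => /addnI.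
  + rewrite size_cat /= size_rcons ks.
    by case: (x) => a /=; [apply/ltn_addr/ltn_ord | rewrite ltn_add2l ltn_ord].
  + rewrite size_cat /= size_rcons ks.
    by case: (x') => a /=; [apply/ltn_addr/ltn_ord | rewrite ltn_add2l ltn_ord].
- have cycP (a b : 'I_k.+3) : a.+1 %% k.+3 == b ->
      adj (nth v (v :: c1) a) (nth v (v :: c1) b).
    move=> /eqP <-; case/and3P: cycv => _ /(pathP v) /(_ a) H _.
    move: H; rewrite size_rcons ks ltn_ord => /(_ isT).
    rewrite -rcons_cons !nth_rcons /= ks ltn_ord.
    have := ltn_ord a; rewrite leq_eqVlt => /orP[/eqP[->]|lt].
      by rewrite modnn ltnn eqxx.
    by rewrite modn_small //= -[a < k.+2]ltnS lt.
  have stepP (a b : 'I_(size r).+1) : a.+1 == b ->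
      adj (nth v (rcons r y) a) (nth v (rcons r y) b).
    move=> /eqP ab; move/(pathP v)/(_ b): pr; rewrite size_rcons ltn_ord -ab /=.
    exact.
  have joinP : adj v (nth v (rcons r y) 0) by case: (r) pr => [|r0 s] /= /andP[].
  case=> a [] b /=; rewrite /cycle_adj /path_adj.
  + by case/andP=> _ /orP[] /cycP //; rewrite adj_sym.
  + by case/andP=> /eqP-> /eqP->.
  + by case/andP=> /eqP-> /eqP->; rewrite adj_sym.
  + by case/orP=> /stepP //; rewrite adj_sym.
- by rewrite /f /= nth_rcons ltnn eqxx.
Qed.

Theorem theorem15 (n k : nat) (hk : 3 <= k) (hkn : k <= n - 1)
    (G : sgraph) (hn : #|G| = n) (hG : unicyclic G)
    (c : seq G) (hc : is_cycle c) (hck : size c = k) :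
  F_index (lollipop n k) <= F_index G /\
  (F_index G = F_index (lollipop n k) <-> graph_iso G (lollipop n k)).
Proof.
have conG := hG.1.
have [k' [m [f [szc fI fH ft]]]] : exists k m (f : pan k m -> G),
    [/\ size c = k.+3, injective f,
        forall x y : pan k m, adj x y -> adj (f x) (f y)
      & degree (f (tip k m)) <= 1].
  apply: pan_hom => //; last by lia.
  by move=> c'; apply: unicyclic_mem_cycle.
pose j := f (joint k' m); pose t := f (tip k' m).
have jt : j != t by rewrite (inj_eq fI).
have dj : 3 <= degree j.
  by apply: leq_trans (degree_hom_le _ fI fH); rewrite degree_joint.
have termP (x : G) : true ->
    12 * degree x + (7 * (x == j) + 5 * (x == t)) <= degree x ^ 3 + 16
      ?= iff (degree x + (x == t) == 2 + (x == j)).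
  move=> _; apply: cube_degree_leqif => [|/eqP->//|/eqP->//].
  by apply: contraNN jt => /andP[/eqP<- /eqP->].
(* The excesses 7 at [j] and 5 at [t] add up to 12; with degree sum at least [2 n], this gives
   [24 n + 12 <= F(G) + 16 n]. *)
have [bound boundE] := leqif_sum termP.
have sum_pred1 (a : G) b : \sum_(x : G) b * (x == a) = b.
  rewrite (bigD1 a) //= eqxx muln1 big1 ?addn0 // => x /negPf->.
  exact: muln0.
have sumL : \sum_(x : G) (12 * degree x + (7 * (x == j) + 5 * (x == t))) =
    12 * (\sum_(x : G) degree x) + 12.
  by rewrite big_split [X in _ + X = _]big_split /= !sum_pred1 big_distrr.
have sumR : \sum_(x : G) (degree x ^ 3 + 16) = F_index G + 16 * n.
  by rewrite big_split /= sum_nat_const -hn mulnC.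
have sumd := sum_degree_ge conG hc.
have {hck} ek : k = k'.+3 by rewrite -hck.
subst k.
(* The path of the lollipop found in [G] may be shorter than that of [lollipop n k], so [m'] is kept
   apart from [m]. *)
have [m' em'] : exists m', n - k'.+3 = m'.+1 by exists (n - k'.+3).-1; lia.
have -> : lollipop n k'.+3 = pan k' m' by rewrite /lollipop em'.
have FL : F_index (pan k' m') = 8 * n + 12 by rewrite F_index_pan; lia.
split; first by rewrite FL; lia.
split; last exact: graph_iso_F_index.
(* Equality of the sums forces equality at every vertex, so each [f u] has the degree that [u] has
   in the lollipop. *)
move=> FG; have : \sum_(x : G) (12 * degree x + (7 * (x == j) + 5 * (x == t))) ==
    \sum_(x : G) (degree x ^ 3 + 16) by rewrite eqn_leq bound sumL sumR FG FL; lia.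
rewrite boundE => /forall_inP degE.
have isoG : graph_iso G (pan k' m).
  apply: (hom_degree_iso (joint k' m) conG fI fH) => u.
  have /eqP := degE (f u) isT; rewrite !(inj_eq fI) -degree_pan; lia.
(* Counting vertices through the isomorphism identifies the two path lengths. *)
suff -> : m' = m by [].
case: isoG => g gB _; have := bij_eq_card gB.
by rewrite card_sum !card_ord; lia.
Qed.
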